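(* Let $(X,d,W)$ be a $W$-hyperbolic space, $C\subseteq X$ a convex subset, $T:C\to C$ a nonexpansive mapping with $Fix(T)\neq\emptyset$, $x_0,u\in C$. Let $\lambda\in(0,1]$, and put $\lambda_n=\lambda$ and $\beta_n=1-\frac1{n+1}$ for every $n\in\mathbb N$. Let $(x_n)$ be the Tikhonov-Mann iteration $x_{n+1}=(1-\lambda_n)u_n+\lambda_n Tu_n$, where $u_n=(1-\beta_n)u+\beta_n x_n$. Let $p\in Fix(T)$ and let $K\in\mathbb N^*$ be such that $K\ge\max\{d(x_0,p),d(u,p)\}$. Then $$\Sigma_0(k)=144K^2(k+1)^2+6K(k+1)$$ is a rate of asymptotic regularity for $(x_n)$, and $$\Phi_0(k)=576K^2\left\lceil\frac1\lambda\right\rceil^2(k+1)^2+12K\left\lceil\frac1\lambda\right\rceil(k+1)$$ is a rate of $T$-asymptotic regularity for $(x_n)$.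
   Context: A $W$-hyperbolic space is a triple $(X,d,W)$ where $(X,d)$ is a metric space and $W:X\times X\times[0,1]\to X$ is a function, with $W(x,y,\lambda)$ denoted by $(1-\lambda)x+\lambda y$, such that for all $x,y,z,w\in X$ and $\lambda,\tilde\lambda\in[0,1]$: (W1) $d(z,W(x,y,\lambda))\le(1-\lambda)d(z,x)+\lambda d(z,y)$; (W2) $d(W(x,y,\lambda),W(x,y,\tilde\lambda))=|\lambda-\tilde\lambda|d(x,y)$; (W3) $W(x,y,\lambda)=W(y,x,1-\lambda)$; (W4) $d(W(x,z,\lambda),W(y,w,\lambda))\le(1-\lambda)d(x,y)+\lambda d(z,w)$. A nonempty $C\subseteq X$ is convex if $W(x,y,\lambda)\in C$ for all $x,y\in C$, $\lambda\in[0,1]$. Thus $u_n=W(u,x_n,\beta_n)$ and $x_{n+1}=W(u_n,Tu_n,\lambda_n)$. $T:C\to C$ is nonexpansive if $d(Tx,Ty)\le d(x,y)$ for all $x,y\in C$; $Fix(T)$ is its set of fixed points. $\mathbb N=\{0,1,2,\dots\}$, $\mathbb N^*=\mathbb N\setminus\{0\}$. A function $\varphi:\mathbb N\to\mathbb N$ is a rate of asymptotic regularity for $(x_n)$ if for all $k\in\mathbb N$ and all $n\ge\varphi(k)$, $d(x_n,x_{n+1})\le\frac1{k+1}$; it is a rate of $T$-asymptotic regularity for $(x_n)$ if for all $k\in\mathbb N$ and all $n\ge\varphi(k)$, $d(x_n,Tx_n)\le\frac1{k+1}$. *)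

(* Defs.v *)
From HB Require Import structures.
From mathcomp Require Import all_boot all_order all_algebra.
From mathcomp Require Import all_classical all_reals all_analysis.

Set Implicit Arguments.
Unset Strict Implicit.
Unset Printing Implicit Defensive.

Import Order.TTheory GRing.Theory Num.Theory.

Local Open Scope classical_set_scope.
Local Open Scope ring_scope.

(* [W x y l] is the point (1 - l) x + l y.  The third argument is a real number
   rather than an element of [0, 1]; the values of W outside [0, 1] are
   unconstrained. *)
Record W_hyperbolic (R : realType) (X : metricType R)
    (W : X -> X -> R -> X) : Prop := WHyperbolic {
  W_hyperbolic1 : forall (x y z : X) (l : R), 0 <= l <= 1 ->
    mdist z (W x y l) <= (1 - l) * mdist z x + l * mdist z y ;
  W_hyperbolic2 : forall (x y : X) (l l' : R), 0 <= l <= 1 -> 0 <= l' <= 1 ->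
    mdist (W x y l) (W x y l') = `|l - l'| * mdist x y ;
  W_hyperbolic3 : forall (x y : X) (l : R), 0 <= l <= 1 ->
    W x y l = W y x (1 - l) ;
  W_hyperbolic4 : forall (x y z w : X) (l : R), 0 <= l <= 1 ->
    mdist (W x z l) (W y w l) <= (1 - l) * mdist x y + l * mdist z w
}.

Definition W_convex (R : realType) (X : metricType R) (W : X -> X -> R -> X)
    (C : set X) : Prop :=
  C !=set0 /\
  forall (x y : X) (l : R), C x -> C y -> 0 <= l <= 1 -> C (W x y l).

(* A self-map of C is represented by a total function T : X -> X mapping C
   into C; only the values of T on C are constrained. *)
Definition nonexpansive_on (R : realType) (X : metricType R) (C : set X)
    (T : X -> X) : Prop :=
  set_fun C C T /\
  forall x y : X, C x -> C y -> mdist (T x) (T y) <= mdist x y.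

Definition Fix (X : Type) (C : set X) (T : X -> X) : set X :=
  [set x | C x /\ T x = x].

Fixpoint tikhonov_mann (R : realType) (X : metricType R) (W : X -> X -> R -> X)
    (T : X -> X) (u x0 : X) (lambda beta : nat -> R) (n : nat) : X :=
  if n is m.+1 then
    let xm := tikhonov_mann W T u x0 lambda beta m in
    let um := W u xm (beta m) in
    W um (T um) (lambda m)
  else x0.

Definition rate_of_asymptotic_regularity (R : realType) (X : metricType R)
    (x : nat -> X) (phi : nat -> nat) : Prop :=
  forall k n : nat, (phi k <= n)%N -> mdist (x n) (x n.+1) <= 1 / k.+1%:R.

Definition rate_of_T_asymptotic_regularity (R : realType) (X : metricType R)
    (T : X -> X) (x : nat -> X) (phi : nat -> nat) : Prop :=
  forall k n : nat, (phi k <= n)%N -> mdist (x n) (T (x n)) <= 1 / k.+1%:R.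

(* Main.v *)
Require Import Defs.
From HB Require Import structures.
From mathcomp Require Import all_boot all_order all_algebra.
From mathcomp Require Import all_classical all_reals all_analysis.
From mathcomp Require Import ring lra zify.

Set Implicit Arguments.
Unset Strict Implicit.
Unset Printing Implicit Defensive.

Import Order.TTheory GRing.Theory Num.Theory.

Local Open Scope classical_set_scope.
Local Open Scope ring_scope.

(** Write [a_n = d(x_n, x_{n+1})].  Every point of the iteration stays within
    [K] of the fixed point [p], so [d(u, x_n) <= 2K].  For a constant [lambda]
    the map [v |-> W v (T v) lambda] is nonexpansive, hence [a_{n+1}] is at most
    [d(u_n, u_{n+1})], and comparing [u_n] with [u_{n+1}] through
    [W u x_n beta_{n+1}] gives
      [a_{n+1} <= beta_{n+1} a_n + |beta_n - beta_{n+1}| d(u, x_n)]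
    ([tikhonov_mann_step_le]).  With [beta_n = 1 - 1/(n+1)] this telescopes:
      [(n+2) a_{n+1} <= (n+1) a_n + 2K / (n+1)],
    so [(n+1) a_n] is bounded by [2K] times one plus a harmonic sum.  As
    [1 / (n+1) <= 3 (sqrt (n+2) - sqrt (n+1))], an induction yields the cleaner
    bound [a_n <= 6K / sqrt (n+1)] ([sqrt_decay]), which is below [1/(k+1)] as
    soon as [n+1 >= 36 K^2 (k+1)^2].

    For [T]-asymptotic regularity, the step from [u_n] to [x_{n+1}] has length
    at least [lambda d(u_n, T u_n)], while [u_n] is within
    [(1 - beta_n) d(u, x_n) <= 2K / (n+1)] of [x_n].  Triangle inequalities give
      [lambda d(x_n, T x_n) <= a_n + 6K / (n+1)]
    ([tikhonov_mann_displacement_le]), so [d(x_n, T x_n)] is at most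
    [12 K L / sqrt (n+1)] for any [L >= 1 / lambda]. *)

(** * Averaged maps of a nonexpansive map *)

Lemma mann_step_nonexpansive (R : realType) (X : metricType R)
    (W : X -> X -> R -> X) (C : set X) (T : X -> X) (v w : X) (l : R) :
  W_hyperbolic W -> nonexpansive_on C T -> C v -> C w -> 0 <= l <= 1 ->
  mdist (W v (T v) l) (W w (T w) l) <= mdist v w.
Proof.
move=> hW [_ neT] Cv Cw l01; have /andP[l0 _] := l01.
apply: le_trans (W_hyperbolic4 hW v w (T v) (T w) l01) _.
have := ler_wpM2l l0 (neT _ _ Cv Cw); lra.
Qed.

(** A point dividing a segment in ratio [l] lies at distance at least [l] times
    the length from the first end, because by (W1) it is at most
    [1 - l] times the length away from the second one. *)
Lemma W_dist_left_ge (R : realType) (X : metricType R) (W : X -> X -> R -> X)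
    (x y : X) (l : R) :
  W_hyperbolic W -> 0 <= l <= 1 -> l * mdist x y <= mdist x (W x y l).
Proof.
move=> hW l01; have := W_hyperbolic1 hW x y y l01.
have := metric_triangle x (W x y l) y.
rewrite mdistxx (metric_sym y x) (metric_sym (W x y l) y); lra.
Qed.

Lemma W_dist_right_le (R : realType) (X : metricType R) (W : X -> X -> R -> X)
    (x y : X) (l : R) :
  W_hyperbolic W -> 0 <= l <= 1 -> mdist (W x y l) y <= (1 - l) * mdist x y.
Proof.
move=> hW l01; have := W_hyperbolic1 hW x y y l01.
rewrite mdistxx (metric_sym y x) (metric_sym y (W x y l)); lra.
Qed.

(** * The Tikhonov-Mann iteration *)

Lemma tikhonov_mann_in (R : realType) (X : metricType R) (W : X -> X -> R -> X)
    (C : set X) (T : X -> X) (u x0 : X) (lambda beta : nat -> R) :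
  W_convex W C -> set_fun C C T -> C u -> C x0 ->
  (forall n, 0 <= lambda n <= 1) -> (forall n, 0 <= beta n <= 1) ->
  forall n, C (tikhonov_mann W T u x0 lambda beta n).
Proof.
move=> [_ cvxC] CT Cu Cx0 l01 b01; elim=> //= n IHn.
by apply: (cvxC) => //; first exact: cvxC; apply: CT; exact: cvxC.
Qed.

(** Balls around a fixed point are invariant: both [W u _ (beta n)] and the
    averaged map of [T] preserve the bound, by (W1). *)
Lemma tikhonov_mann_bounded (R : realType) (X : metricType R)
    (W : X -> X -> R -> X) (C : set X) (T : X -> X) (u x0 p : X)
    (lambda beta : nat -> R) (M : R) :
  W_hyperbolic W -> W_convex W C -> nonexpansive_on C T -> C u -> C x0 ->
  (forall n, 0 <= lambda n <= 1) -> (forall n, 0 <= beta n <= 1) ->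
  Fix C T p -> mdist u p <= M -> mdist x0 p <= M ->
  forall n, mdist (tikhonov_mann W T u x0 lambda beta n) p <= M.
Proof.
move=> hW hC [CT neT] Cu Cx0 l01 b01 [Cp Tp] uM x0M; elim=> //= n IHn.
have Cx := tikhonov_mann_in hC CT Cu Cx0 l01 b01 n.
set x := tikhonov_mann _ _ _ _ _ _ n in IHn Cx *; set v := W u x _.
have vM : mdist v p <= M.
  have := W_hyperbolic1 hW u x p (b01 n); rewrite -/v.
  rewrite !(metric_sym p) => /le_trans; apply.
  have /andP[b0 b1] := b01 n; have b1' : 0 <= 1 - beta n by lra.
  have := ler_wpM2l b0 IHn; have := ler_wpM2l b1' uM; lra.
have Cv : C v by case: hC => _; exact.
have TvM : mdist (T v) p <= M.
  by apply: le_trans vM; rewrite -{1}Tp; exact: neT.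
have := W_hyperbolic1 hW v (T v) p (l01 n).
rewrite !(metric_sym p) => /le_trans; apply.
have /andP[l0 l1] := l01 n; have l1' : 0 <= 1 - lambda n by lra.
have := ler_wpM2l l0 TvM; have := ler_wpM2l l1' vM; lra.
Qed.

(** Inserting [W u x_n beta_{n+1}] between [u_n] and [u_{n+1}] separates the
    change of the parameter, measured by (W2), from the change of the point,
    contracted by (W4). *)
Lemma tikhonov_mann_step_le (R : realType) (X : metricType R)
    (W : X -> X -> R -> X) (C : set X) (T : X -> X) (u x0 : X) (l : R)
    (beta : nat -> R) (n : nat) (x := tikhonov_mann W T u x0 (fun=> l) beta) :
  W_hyperbolic W -> W_convex W C -> nonexpansive_on C T -> C u -> C x0 ->
  0 <= l <= 1 -> (forall n, 0 <= beta n <= 1) ->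
  mdist (x n.+1) (x n.+2) <= beta n.+1 * mdist (x n) (x n.+1)
                             + `|beta n - beta n.+1| * mdist u (x n).
Proof.
move=> hW hC hT Cu Cx0 l01 b01.
have Cx m : C (x m) by exact: (tikhonov_mann_in hC hT.1 Cu Cx0 (fun=> l01)).
have Cv m : C (W u (x m) (beta m)) by case: hC => _; exact.
apply: le_trans (mann_step_nonexpansive hW hT (Cv n) (Cv n.+1) l01) _.
apply: le_trans (metric_triangle _ (W u (x n) (beta n.+1)) _) _.
rewrite W_hyperbolic2// [leRHS]addrC lerD2l.
have := W_hyperbolic4 hW u u (x n) (x n.+1) (b01 n.+1).
by rewrite mdistxx mulr0 add0r.
Qed.

(** Passing from [x_n] to [u_n] costs [d(x_n, u_n)] three times: twice in
    replacing [d(x_n, T x_n)] by [d(u_n, T u_n)], once in replacing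
    [d(u_n, x_{n+1})] by [d(x_n, x_{n+1})].  The bound [lambda n <= 1] absorbs
    the factor in front of the first two. *)
Lemma tikhonov_mann_displacement_le (R : realType) (X : metricType R)
    (W : X -> X -> R -> X) (C : set X) (T : X -> X) (u x0 : X)
    (lambda beta : nat -> R) (n : nat)
    (x := tikhonov_mann W T u x0 lambda beta) :
  W_hyperbolic W -> W_convex W C -> nonexpansive_on C T -> C u -> C x0 ->
  (forall n, 0 <= lambda n <= 1) -> (forall n, 0 <= beta n <= 1) ->
  lambda n * mdist (x n) (T (x n)) <=
    mdist (x n) (x n.+1) + 3 * ((1 - beta n) * mdist u (x n)).
Proof.
move=> hW hC [CT neT] Cu Cx0 l01 b01.
have Cx : C (x n) by exact: (tikhonov_mann_in hC).
set v := W u (x n) (beta n); have Cv : C v by case: hC => _; exact.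
have vx := W_dist_right_le u (x n) hW (b01 n); rewrite -/v in vx.
have Tvx := neT _ _ Cv Cx.
have lTv : lambda n * mdist v (T v) <= mdist v (x n.+1).
  exact: W_dist_left_ge.
have vx1 := metric_triangle v (x n) (x n.+1).
have xTx : mdist (x n) (T (x n)) <= 2 * mdist v (x n) + mdist v (T v).
  have := metric_triangle (x n) v (T (x n)).
  have := metric_triangle v (T v) (T (x n)).
  rewrite (metric_sym (x n) v); lra.
have /andP[l0 l1] := l01 n.
have := ler_wpM2l l0 xTx; have := ler_wpM2r (mdist_ge0 v (x n)) l1; lra.
Qed.

(** * Square-root decay *)

(** The induction works because the harmonic increment [1 / (n+1)] is at most
    [3 (sqrt (n+2) - sqrt (n+1)) = 3 / (sqrt (n+2) + sqrt (n+1))]. *)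
Lemma sqrt_decay (R : realType) (M : R) (a : nat -> R) :
  0 <= M -> a 0%N <= M ->
  (forall n, a n.+1 <= (1 - 1 / n.+2%:R) * a n + M / (n.+1%:R * n.+2%:R)) ->
  forall n, a n * Num.sqrt n.+1%:R <= 3 * M.
Proof.
move=> M0 a0 aS; elim=> [|n IHn]; first by rewrite sqrtr1; lra.
set s := Num.sqrt n.+1%:R in IHn; set t := Num.sqrt n.+2%:R.
have s2 : s ^+ 2 = n.+1%:R by rewrite sqr_sqrtr.
have t2 : t ^+ 2 = n.+2%:R by rewrite sqr_sqrtr.
have ts2 : t ^+ 2 = s ^+ 2 + 1 by rewrite s2 t2 -natr1.
have s1 : 1 <= s by rewrite -sqrtr1 ler_wsqrtr// ler1n.
have t0 : 0 < t by rewrite sqrtr_gt0.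
have s_gt0 : 0 < s by lra.
have := aS n; rewrite -s2 -t2 => {}aS.
have st : s <= t by rewrite ler_wsqrtr// ler_nat.
have ss : s <= s ^+ 2 by rewrite expr2 ler_peMr // ltW.
have t2s : t <= 2 * s.
  by rewrite -ler_sqr ?nnegrE ?mulr_ge0 ?(ltW t0) ?(ltW s_gt0)// exprMn; lra.
(* Since [t ^+ 2 - s ^+ 2 = 1], the difference [t - s] is the inverse of
   [t + s], which is at most [3 * s] and hence at most [3 * s ^+ 2]. *)
have inc : (s ^+ 2)^-1 <= 3 * (t - s).
  have ts1 : (t - s) * (t + s) = 1 by rewrite -subr_sqr ts2 addrC addKr.
  have ts3 : t + s <= 3 * s ^+ 2 by lra.
  have ts0 : 0 <= t - s by rewrite subr_ge0.
  rewrite -[leLHS]mul1r ler_pdivrMr ?exprn_gt0//.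
  have := ler_wpM2l ts0 ts3; lra.
have at2 : a n.+1 * t ^+ 2 <= s * (a n * s) + M * (s ^+ 2)^-1.
  have := ler_wpM2r (sqr_ge0 t) aS.
  have -> : ((1 - 1 / t ^+ 2) * a n + M / (s ^+ 2 * t ^+ 2)) * t ^+ 2
          = (t ^+ 2 - 1) * a n + M * (s ^+ 2)^-1.
    by field; rewrite ?gt_eqF//; lra.
  rewrite ts2; lra.
rewrite -(ler_pM2r t0).
have := ler_wpM2l (ltW s_gt0) IHn; have := ler_wpM2l M0 inc; lra.
Qed.

Lemma le_inv_of_sqrt_decay (R : realType) (d : R) (N n k : nat) :
  0 <= d -> (0 < N)%N -> d * Num.sqrt n.+1%:R <= N%:R ->
  (N ^ 2 * k.+1 ^ 2 <= n.+1)%N -> d <= 1 / k.+1%:R.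
Proof.
move=> d0 N0 dN Nn.
have Nks : N%:R * k.+1%:R <= Num.sqrt n.+1%:R :> R.
  rewrite -[leLHS]ger0_norm ?mulr_ge0// -sqrtr_sqr ler_wsqrtr//.
  by rewrite -natrM -natrX ler_nat expnMn.
rewrite ler_pdivlMr// -(ler_pM2l (x := N%:R)) ?ltr0n// mulr1.
apply: le_trans dN; rewrite mulrCA; exact: ler_wpM2l.
Qed.

(** * Rates for the parameters [beta_n = 1 - 1 / (n+1)] *)

Theorem corollary4p3 (R : realType) (X : metricType R) (W : X -> X -> R -> X)
    (C : set X) (T : X -> X) (x0 u p : X) (lambda : R) (K : nat)
    (hW : W_hyperbolic W) (hC : W_convex W C) (hT : nonexpansive_on C T)
    (hFix : Fix C T !=set0) (hx0 : C x0) (hu : C u)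
    (hlambda : 0 < lambda <= 1) (hp : Fix C T p)
    (hK0 : (0 < K)%N) (hK : Num.max (mdist x0 p) (mdist u p) <= K%:R) :
  let lambda_ : nat -> R := fun _ => lambda in
  let beta_ : nat -> R := fun n => 1 - 1 / n.+1%:R in
  let x : nat -> X := tikhonov_mann W T u x0 lambda_ beta_ in
  let L : nat := `|Num.ceil (1 / lambda)|%N in
  rate_of_asymptotic_regularity x
    (fun k => 144 * K ^ 2 * (k + 1) ^ 2 + 6 * K * (k + 1))%N /\
  rate_of_T_asymptotic_regularity T x
    (fun k => 576 * K ^ 2 * L ^ 2 * (k + 1) ^ 2 + 12 * K * L * (k + 1))%N.
Proof.
move=> lambda_ beta_ x L.
have [l_gt0 l_le1] := andP hlambda.
have l01 : 0 <= lambda <= 1 by rewrite ltW.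
have b01 n : 0 <= beta_ n <= 1.
  rewrite /beta_ subr_ge0 gerBl divr_ge0// andbT.
  by rewrite ler_pdivrMr// mul1r ler1n.
move: hK; rewrite ge_max => /andP[x0K uK].
have xK n : mdist (x n) p <= K%:R.
  exact: (tikhonov_mann_bounded hW hC hT hu hx0 (fun=> l01) b01 hp).
have uxK n : mdist u (x n) <= 2 * K%:R.
  have := metric_triangle u p (x n); rewrite (metric_sym p).
  have := xK n; lra.
have xxK : mdist (x 0%N) (x 1%N) <= 2 * K%:R.
  have := metric_triangle (x 0%N) p (x 1%N); rewrite (metric_sym p).
  have := xK 0%N; have := xK 1%N; lra.
have decay : forall n,
    mdist (x n) (x n.+1) * Num.sqrt n.+1%:R <= 3 * (2 * K%:R).
  apply: sqrt_decay; [by rewrite mulr_ge0|exact: xxK|move=> n].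
  apply: le_trans (tikhonov_mann_step_le n hW hC hT hu hx0 l01 b01) _.
  have -> : `|beta_ n - beta_ n.+1| = (n.+1%:R * n.+2%:R)^-1.
    have -> : beta_ n - beta_ n.+1 = - (n.+1%:R * n.+2%:R)^-1.
      rewrite /beta_ -[n.+2%:R]natr1; field.
      by rewrite nat1r natr1 !pnatr_eq0.
    by rewrite normrN ger0_norm// invr_ge0 mulr_ge0.
  rewrite lerD2l [leRHS]mulrC ler_wpM2l ?invr_ge0 ?mulr_ge0//; exact: uxK.
have L_ge : 1 <= lambda * L%:R.
  rewrite mulrC -ler_pdivrMr//; apply: le_trans (Num.Theory.ceil_ge _) _.
  by rewrite -[L%:R]/(L%:Z%:~R) ler_int abszE ler_norm.
have L_gt0 : (0 < L)%N.
  by rewrite lt0n; apply/eqP => L0; move: L_ge; rewrite L0 mulr0 ler10.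
have Tdecay n : mdist (x n) (T (x n)) * Num.sqrt n.+1%:R <= (12 * K * L)%:R.
  set s := Num.sqrt n.+1%:R.
  have s1 : 1 <= s by rewrite -sqrtr1 ler_wsqrtr// ler1n.
  have ns2 : n.+1%:R = s ^+ 2 by rewrite sqr_sqrtr.
  have s_gt0 : 0 < s by lra.
  have disp := tikhonov_mann_displacement_le n hW hC hT hu hx0 (fun=> l01) b01.
  have ldisp : lambda * mdist (x n) (T (x n)) * s <= 12 * K%:R.
    have h : (1 - beta_ n) * mdist u (x n) * s <= 2 * K%:R.
      rewrite /beta_ subKr ns2.
      have -> : 1 / s ^+ 2 * mdist u (x n) * s = mdist u (x n) / s.
        by field; rewrite gt_eqF.
      rewrite ler_pdivrMr//; apply: le_trans (uxK n) _.
      by rewrite ler_peMr// mulr_ge0.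
    have := ler_wpM2r (ltW s_gt0) disp; have := decay n.
    rewrite -/x -/s /lambda_; lra.
  rewrite !natrM.
  have dsL : 0 <= mdist (x n) (T (x n)) * s.
    by rewrite mulr_ge0// ?mdist_ge0// ltW.
  (* [L] stands for [1 / lambda], so it cancels the factor in [ldisp]. *)
  have := ler_wpM2r dsL L_ge.
  have := ler_wpM2r (ler0n R L) ldisp; lra.
split=> k n kn.
  apply: (@le_inv_of_sqrt_decay _ _ (6 * K)%N n);
    rewrite ?mdist_ge0 ?muln_gt0//.
    by have := decay n; rewrite natrM; lra.
  by move: kn; rewrite addn1; nia.
apply: (@le_inv_of_sqrt_decay _ _ (12 * K * L)%N n).
- exact: mdist_ge0.
- by rewrite !muln_gt0 hK0.
- exact: Tdecay.
- move: kn; rewrite addn1 !expnMn; nia.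
Qed.
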